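(* Let $A\in\mathbb{C}^{n\times n}$ and let $B\in\mathbb{C}^{n\times n}$ be a nonzero matrix, written in the core-EP decomposition of the pair $\{A,B\}$: $$A=U\begin{bmatrix}A_1&A_{12}\\0&A_2\end{bmatrix}V^*,\qquad B=V\begin{bmatrix}B_1&B_{12}\\0&B_2\end{bmatrix}U^*,$$ where $U,V\in\mathbb{C}^{n\times n}$ are unitary, $A_1,B_1\in\mathbb{C}^{t\times t}$ are nonsingular, and $A_2,B_2\in\mathbb{C}^{(n-t)\times(n-t)}$ are such that $A_2B_2$ and $B_2A_2$ are nilpotent of indices $\mathrm{Ind}(AB)$ and $\mathrm{Ind}(BA)$, respectively. Then $$A^{(B)}=V\begin{bmatrix}A_1^*\Omega&-A_1^*\Omega MN^\dagger\\(I_{n-t}-Q_N)M^*\Omega&N^\dagger-(I_{n-t}-Q_N)M^*\Omega MN^\dagger\end{bmatrix}U^*,$$ where $M=A_{12}P_{B_2}$, $N=A_2P_{B_2}$ and $\Omega=\bigl(A_1A_1^*+M(I_{n-t}-Q_N)M^*\bigr)^{-1}$.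
   Context: $M^*$ is the conjugate transpose and $M^\dagger$ the Moore-Penrose inverse of a complex matrix $M$; $P_M:=MM^\dagger$ and $Q_M:=M^\dagger M$. $\mathrm{Ind}(M)$ is the smallest nonnegative integer $k$ with $\mathrm{rk}(M^{k+1})=\mathrm{rk}(M^k)$. For $A,B\in\mathbb{C}^{n\times n}$, the generalized inverse of $A$ with respect to $B$ is $A^{(B)}:=(ABB^\dagger)^\dagger$. *)

(* Defs.v *)
From HB Require Import structures.
From mathcomp Require Import all_boot all_order all_algebra spectral.

Set Implicit Arguments.
Unset Strict Implicit.
Unset Printing Implicit Defensive.

Import Order.TTheory GRing.Theory Num.Theory Num.Def.
Local Open Scope ring_scope.
Local Open Scope sesquilinear_scope.

Definition penrose (C : numClosedFieldType) (m n : nat)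
    (A : 'M[C]_(m, n)) (X : 'M[C]_(n, m)) : bool :=
  [&& A *m X *m A == A, X *m A *m X == X,
      (A *m X)^t* == A *m X & (X *m A)^t* == X *m A].

Section MoorePenrose.
Variable C : numClosedFieldType.

Lemma trmxC_mul m n p (A : 'M[C]_(m, n)) (B : 'M[C]_(n, p)) :
  (A *m B)^t* = B^t* *m A^t*.
Proof. by rewrite trmx_mul map_mxM. Qed.

Lemma trmxC_inv n (A : 'M[C]_n) : (invmx A)^t* = invmx (A^t*).
Proof. by rewrite trmx_inv map_invmx. Qed.

Lemma mulmx_trmxC_eq0 m n (A : 'M[C]_(m, n)) : A *m A^t* = 0 -> A = 0.
Proof.
move=> AA0; apply/matrixP => i j; rewrite mxE; apply/eqP.
have /matrixP/(_ i i)/eqP := AA0; rewrite !mxE psumr_eq0; last first.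
  by move=> k _; rewrite !mxE mul_conjC_ge0.
by move/allP/(_ j (mem_index_enum j)); rewrite !mxE mul_conjC_eq0.
Qed.

Lemma gram_unitmx m n (A : 'M[C]_(m, n)) : row_free A -> A *m A^t* \in unitmx.
Proof.
move=> Afree; rewrite -row_free_unit -kermx_eq0; apply/eqP.
set K := kermx _; apply/eqP; rewrite -(mulmx_free_eq0 _ Afree); apply/eqP.
apply: mulmx_trmxC_eq0.
by rewrite trmxC_mul !mulmxA -[K *m A *m _]mulmxA mulmx_ker mul0mx.
Qed.

Lemma penrose_mul m r n (L : 'M[C]_(m, r)) (R : 'M[C]_(r, n)) :
    L^t* *m L \in unitmx -> R *m R^t* \in unitmx ->
  penrose (L *m R)
    (R^t* *m invmx (R *m R^t*) *m (invmx (L^t* *m L) *m L^t*)).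
Proof.
move=> uL uR; set P := invmx (R *m _); set Q := invmx (_ *m L).
have Ph : P^t* = P by rewrite trmxC_inv trmxC_mul trmxCK.
have Qh : Q^t* = Q by rewrite trmxC_inv trmxC_mul trmxCK.
have RP : R *m (R^t* *m P) = 1%:M by rewrite mulmxA mulmxV.
have QL : (Q *m L^t*) *m L = 1%:M by rewrite -mulmxA mulVmx.
set X := _ *m (Q *m _).
have AX : L *m R *m X = L *m (Q *m L^t*).
  by rewrite /X (mulmxA (L *m R)) -(mulmxA L R) RP mulmx1.
have XA : X *m (L *m R) = R^t* *m P *m R.
  by rewrite /X (mulmxA _ L) -(mulmxA _ _ L) QL mulmx1.
apply/and4P; split; apply/eqP.
- by rewrite AX mulmxA -(mulmxA L _ L) QL mulmx1.
- by rewrite XA /X (mulmxA (_ *m R)) -(mulmxA _ R) RP mulmx1.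
- by rewrite AX !trmxC_mul trmxCK Qh mulmxA.
- by rewrite XA !trmxC_mul trmxCK Ph mulmxA.
Qed.

Lemma penrose_exists m n (A : 'M[C]_(m, n)) : exists X, penrose A X.
Proof.
rewrite -(mulmx_base A); eexists; apply: penrose_mul; last first.
  by rewrite gram_unitmx ?row_base_free.
rewrite -{2}[col_base A]trmxCK gram_unitmx // /row_free mxrank_map mxrank_tr.
exact: col_base_full.
Qed.

Lemma penrose_unique m n (A : 'M[C]_(m, n)) X Y :
  penrose A X -> penrose A Y -> X = Y.
Proof.
case/and4P=> /eqP X1 /eqP X2 /eqP X3 /eqP X4.
case/and4P=> /eqP Y1 /eqP Y2 /eqP Y3 /eqP Y4.
have AXY : A *m X = A *m Y.
  rewrite -X3 -Y3 -[in LHS]Y1 -[A *m Y *m A *m X]mulmxA trmxC_mul X3 Y3.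
  by rewrite mulmxA X1.
have XYA : X *m A = Y *m A.
  rewrite -X4 -Y4 -[in LHS]Y1 -mulmxA mulmxA trmxC_mul X4 Y4.
  by rewrite -mulmxA (mulmxA A) X1.
by rewrite -X2 -mulmxA AXY mulmxA XYA Y2.
Qed.

End MoorePenrose.

(* The Moore-Penrose inverse A^dagger, the unique X with [penrose A X]. *)
Definition mpinv (C : numClosedFieldType) (m n : nat) (A : 'M[C]_(m, n)) :
  'M[C]_(n, m) := xchoose (penrose_exists A).

Lemma mpinvP (C : numClosedFieldType) (m n : nat) (A : 'M[C]_(m, n)) :
  penrose A (mpinv A).
Proof. exact: xchooseP. Qed.

Lemma mpinv_unique (C : numClosedFieldType) (m n : nat)
    (A : 'M[C]_(m, n)) (X : 'M[C]_(n, m)) : penrose A X -> mpinv A = X.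
Proof. by move=> AX; apply: penrose_unique (mpinvP A) AX. Qed.

(* [rangeproj M] is P_M and [corangeproj M] is Q_M. *)
Definition rangeproj (C : numClosedFieldType) (m n : nat) (M : 'M[C]_(m, n)) :
  'M[C]_m := M *m mpinv M.

Definition corangeproj (C : numClosedFieldType) (m n : nat) (M : 'M[C]_(m, n)) :
  'M[C]_n := mpinv M *m M.

Definition geninv (C : numClosedFieldType) (n : nat) (A B : 'M[C]_n) :
  'M[C]_n := mpinv (A *m B *m mpinv B).

Lemma mxind_exists (F : fieldType) (n : nat) (M : 'M[F]_n) :
  exists k, \rank (M ^+ k.+1) == \rank (M ^+ k).
Proof.
have decr k : (\rank (M ^+ k.+1) <= \rank (M ^+ k))%N.
  by rewrite exprS mxrankM_maxr.
have [r] := ubnP (\rank (M ^+ 0)); elim: r 0%N => // r IHr k ltr.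
have [/eqP eqk|ltk] := eqVneq (\rank (M ^+ k.+1)) (\rank (M ^+ k)).
  by exists k.
apply: (IHr k.+1); rewrite ltnS in ltr; apply: leq_trans ltr.
by rewrite ltn_neqAle ltk decr.
Qed.

Definition mxind (F : fieldType) (n : nat) (M : 'M[F]_n) : nat :=
  ex_minn (mxind_exists M).

(* The only 0 x 0 matrix is nilpotent of index 0, consistently with
   [mxind M = 0] for nonsingular [M]. *)
Definition nilpotent_of_index (R : pzRingType) (n : nat) (M : 'M[R]_n)
    (k : nat) : Prop :=
  M ^+ k = 0 /\ forall j, (j < k)%N -> M ^+ j <> 0.

(* Main.v *)
Require Import Defs.
From mathcomp Require Import all_boot all_order all_algebra spectral.
From mathcomp Require Import reals.
From mathcomp.real_closed Require Import complex.

(** The Moore-Penrose inverse is compatible with multiplication by unitary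
    matrices on either side, so only the middle block matrices matter.  With
    [B1] nonsingular, the range of the triangular factor of [B] is the whole of
    the first block plus the range of [B2], so its orthogonal projector is
    [diag(1, P_B2)] ([rangeproj_block]).  Hence [A *m rangeproj B] equals
    [U *m K *m V^t*] with [K] the triangular matrix of blocks [A1, M, 0, N],
    and the problem reduces to inverting [K] ([mpinv_block]).

    Since [A1] is nonsingular, the range of [K] is the whole of the first block
    plus the range of [N], so [K] has range projector [diag(1, P_N)].  Only
    the component of [M] on the kernel of [N], that is [M (1 - Q_N)], competes
    with [A1] in the first block row.  Put [L = (A1 | M (1 - Q_N))]: it has
    full row rank, so its Gram matrix [L L^t* = G] is invertible
    ([unitmx_block_gram]), and the first block column of the inverse of [K] is
    the right inverse [L^t* Omega] of [L].  The second block column has [N^+]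
    as its lower block, which contributes [M N^+] to the first row; subtracting
    [L^t* Omega M N^+] cancels this contribution. *)

Import Order.TTheory GRing.Theory Num.Theory Num.Def.
Local Open Scope ring_scope.
Local Open Scope complex_scope.
Local Open Scope sesquilinear_scope.

Section Adjoint.
Variable C : numClosedFieldType.

Lemma trmxC1 n : (1%:M : 'M[C]_n)^t* = 1%:M.
Proof. by rewrite trmx1 map_mx1. Qed.

Lemma trmxCD m n (A B : 'M[C]_(m, n)) : (A + B)^t* = A^t* + B^t*.
Proof. by rewrite linearD map_mxD. Qed.

Lemma trmxCB m n (A B : 'M[C]_(m, n)) : (A - B)^t* = A^t* - B^t*.
Proof. by rewrite linearB map_mxB. Qed.

Lemma trmxC_block m1 m2 n1 n2 (A : 'M[C]_(m1, n1)) (B : 'M[C]_(m1, n2))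
    (D : 'M[C]_(m2, n1)) (E : 'M[C]_(m2, n2)) :
  (block_mx A B D E)^t* = block_mx (A^t*) (D^t*) (B^t*) (E^t*).
Proof. by rewrite tr_block_mx map_block_mx. Qed.

Lemma unitary_mulmxtC n (U : 'M[C]_n) : U \is unitarymx -> U^t* *m U = 1%:M.
Proof. by move/unitarymxP/mulmx1C. Qed.

Lemma mpinv_unitary m n (U : 'M[C]_m) (V : 'M[C]_n) (K : 'M[C]_(m, n)) :
    U \is unitarymx -> V \is unitarymx ->
  mpinv (U *m K *m V^t*) = V *m mpinv K *m U^t*.
Proof.
move=> /unitary_mulmxtC UU /unitary_mulmxtC VV; apply: mpinv_unique.
case/and4P: (mpinvP K) => /eqP X1 /eqP X2 /eqP X3 /eqP X4.
have KX : U *m K *m V^t* *m (V *m mpinv K *m U^t*) = U *m (K *m mpinv K) *m U^t*.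
  by rewrite !mulmxA -(mulmxA _ (V^t*)) VV mulmx1.
have XK : V *m mpinv K *m U^t* *m (U *m K *m V^t*) = V *m (mpinv K *m K) *m V^t*.
  by rewrite !mulmxA -(mulmxA _ (U^t*)) UU mulmx1.
apply/and4P; split; apply/eqP.
- by rewrite KX !mulmxA -(mulmxA _ (U^t*)) UU mulmx1 -!(mulmxA U) X1.
- by rewrite XK !mulmxA -(mulmxA _ (V^t*)) VV mulmx1 -!(mulmxA V) X2.
- by rewrite KX 2!trmxC_mul X3 trmxCK !mulmxA.
- by rewrite XK 2!trmxC_mul X4 trmxCK !mulmxA.
Qed.

End Adjoint.

Section Projectors.
Variable C : numClosedFieldType.

Lemma rangeproj_unitary m n (V : 'M[C]_m) (U : 'M[C]_n) (K : 'M[C]_(m, n)) :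
    V \is unitarymx -> U \is unitarymx ->
  rangeproj (V *m K *m U^t*) = V *m rangeproj K *m V^t*.
Proof.
move=> hV hU; rewrite /rangeproj mpinv_unitary // !mulmxA.
by rewrite -(mulmxA _ (U^t*)) unitary_mulmxtC // mulmx1.
Qed.

(** [BY] and [P_B] have the same range, so each fixes the other when multiplied
    on the left; taking adjoints of one of these equations identifies them. *)
Lemma rangeproj_unique m n (B : 'M[C]_(m, n)) (Y : 'M[C]_(n, m)) :
  (B *m Y)^t* = B *m Y -> B *m Y *m B = B -> rangeproj B = B *m Y.
Proof.
move=> hBY BYB; case/and4P: (mpinvP B) => /eqP X1 _ /eqP X3 _.
by rewrite /rangeproj -X3 -{1}BYB -mulmxA trmxC_mul X3 hBY mulmxA X1.
Qed.

Lemma rangeproj_block t m n (B1 : 'M[C]_t) (B12 : 'M[C]_(t, n))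
    (B2 : 'M[C]_(m, n)) : B1 \in unitmx ->
  rangeproj (block_mx B1 B12 0 B2) = block_mx 1%:M 0 0 (rangeproj B2).
Proof.
move=> uB1; case/and4P: (mpinvP B2) => /eqP X1 _ /eqP X3 _.
(* [Y] is the block inverse formula, with [mpinv B2] for the inverse of [B2]. *)
pose Y := block_mx (invmx B1) (- (invmx B1 *m B12 *m mpinv B2)) 0 (mpinv B2).
have BY : block_mx B1 B12 0 B2 *m Y = block_mx 1%:M 0 0 (rangeproj B2).
  rewrite mulmx_block !mul0mx !mulmx0 !addr0 add0r mulmxV //.
  by rewrite mulmxN !mulmxA mulmxV // mul1mx addNr.
rewrite -BY; apply: rangeproj_unique; rewrite BY.
  by rewrite trmxC_block trmxC1 X3 !trmx0 !map_mx0.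
by rewrite mulmx_block !mul1mx !mul0mx !mulmx0 !addr0 add0r X1.
Qed.

End Projectors.

Section BlockInverse.
Variables (C : numClosedFieldType) (t m n : nat).
Variables (A : 'M[C]_t) (M : 'M[C]_(t, n)) (N : 'M[C]_(m, n)).
Hypothesis uA : A \in unitmx.

Let J := mpinv N.
Let Q := 1%:M - corangeproj N.
Let G := A *m A^t* + M *m Q *m M^t*.
Let W := invmx G.

Let NJN : N *m J *m N = N.
Proof. by case/and4P: (mpinvP N) => /eqP. Qed.

Let JNJ : J *m N *m J = J.
Proof. by case/and4P: (mpinvP N) => _ /eqP. Qed.

Let NJ_herm : (N *m J)^t* = N *m J.
Proof. by case/and4P: (mpinvP N) => _ _ /eqP. Qed.

Let JN_herm : (J *m N)^t* = J *m N.
Proof. by case/and4P: (mpinvP N) => _ _ _ /eqP. Qed.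

Let Q_herm : Q^t* = Q.
Proof. by rewrite trmxCB trmxC1 JN_herm. Qed.

Let mulQ p (D : 'M[C]_(p, n)) : D *m Q = D - D *m J *m N.
Proof. by rewrite mulmxBr mulmx1 mulmxA. Qed.

Let NQ : N *m Q = 0.
Proof. by rewrite mulQ NJN subrr. Qed.

Let QQ : Q *m Q = Q.
Proof. by rewrite {1}/Q mulmxBl mul1mx -mulmxA NQ mulmx0 subr0. Qed.

(** [G] is the Gram matrix of the rows of [(A | M Q)], which are independent
    because those of [A] already are. *)
Lemma unitmx_block_gram : G \in unitmx.
Proof.
have -> : G = row_mx A (M *m Q) *m (row_mx A (M *m Q))^t*.
  rewrite tr_row_mx map_col_mx mul_row_col trmxC_mul Q_herm.
  by rewrite !mulmxA -(mulmxA M Q Q) QQ.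
apply: gram_unitmx; apply/row_freeP.
by exists (col_mx (invmx A) 0); rewrite mul_row_col mulmxV // mulmx0 addr0.
Qed.

Let G_herm : G^t* = G.
Proof. by rewrite trmxCD !trmxC_mul !trmxCK Q_herm !mulmxA. Qed.

Let W_herm : W^t* = W.
Proof. by rewrite trmxC_inv G_herm. Qed.

Let GW : A *m A^t* *m W + M *m Q *m M^t* *m W = 1%:M.
Proof. by rewrite -mulmxDl mulmxV ?unitmx_block_gram. Qed.

(** With [K] the block matrix and [X] its candidate inverse, [K X] is
    [diag(1, P_N)] and [X K] is [(A | M Q)^* W (A | M Q) + diag(0, Q_N)]:
    both are visibly Hermitian. *)
Lemma mpinv_block :
  mpinv (block_mx A M 0 N) =
  block_mx (A^t* *m W) (- (A^t* *m W *m M *m J))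
           (Q *m M^t* *m W) (J - Q *m M^t* *m W *m M *m J).
Proof.
apply: mpinv_unique; set K := block_mx A _ _ _; set X := block_mx _ _ _ _.
have KX : K *m X = block_mx 1%:M 0 0 (N *m J).
  rewrite mulmx_block !mul0mx !add0r; congr block_mx.
  - by rewrite !mulmxA GW.
  - rewrite mulmxN mulmxBr !mulmxA addrCA -opprD.
    by rewrite -2!mulmxDl GW mul1mx subrr.
  - by rewrite !mulmxA NQ !mul0mx.
  - by rewrite mulmxBr !mulmxA NQ !mul0mx subr0.
have XK : X *m K = block_mx (A^t* *m W *m A) (A^t* *m W *m M *m Q)
    (Q *m M^t* *m W *m A) (J *m N + Q *m M^t* *m W *m M *m Q).
  rewrite mulmx_block !mulmx0 !addr0; congr block_mx.
  - by rewrite mulNmx mulQ.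
  - by rewrite (mulmxBl J) mulQ addrCA.
apply/and4P; split; apply/eqP.
- by rewrite KX mulmx_block !mul1mx !mul0mx !mulmx0 !addr0 add0r NJN.
- rewrite -mulmxA KX mulmx_block !mulmx1 !mulmx0 !addr0 !add0r.
  rewrite mulNmx (mulmxBl J) -!mulmxA.
  by rewrite !(mulmxA J) JNJ !mulmxA.
- by rewrite KX trmxC_block trmxC1 NJ_herm !trmx0 !map_mx0.
- rewrite XK trmxC_block trmxCD JN_herm !trmxC_mul !trmxCK Q_herm W_herm.
  by rewrite !mulmxA.
Qed.

End BlockInverse.

Theorem theorem2p5 (R : realType) (t s : nat) (A B : 'M[R[i]]_(t + s))
    (U V : 'M[R[i]]_(t + s))
    (A1 B1 : 'M[R[i]]_t) (A12 B12 : 'M[R[i]]_(t, s)) (A2 B2 : 'M[R[i]]_s)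
    (hB : B <> 0)
    (hU : U \is unitarymx) (hV : V \is unitarymx)
    (hA1 : A1 \in unitmx) (hB1 : B1 \in unitmx)
    (hAB : nilpotent_of_index (A2 *m B2) (mxind (A *m B)))
    (hBA : nilpotent_of_index (B2 *m A2) (mxind (B *m A)))
    (hA : A = U *m block_mx A1 A12 0 A2 *m V^t*)
    (hB' : B = V *m block_mx B1 B12 0 B2 *m U^t*) :
  let M := A12 *m rangeproj B2 in
  let N := A2 *m rangeproj B2 in
  let G := A1 *m A1^t* + M *m (1%:M - corangeproj N) *m M^t* in
  let Omega := invmx G in
  G \in unitmx /\
  geninv A B =
    V *m block_mx
      (A1^t* *m Omega)
      (- (A1^t* *m Omega *m M *m mpinv N))
      ((1%:M - corangeproj N) *m M^t* *m Omega)
      (mpinv N - (1%:M - corangeproj N) *m M^t* *m Omega *m M *m mpinv N)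
    *m U^t*.
Proof.
move=> M N G Omega; split; first exact: unitmx_block_gram.
have AP : A *m B *m mpinv B = U *m block_mx A1 M 0 N *m V^t*.
  rewrite -mulmxA -/(rangeproj B) hB' rangeproj_unitary // rangeproj_block //.
  rewrite hA !mulmxA -(mulmxA _ (V^t*) V) unitary_mulmxtC // mulmx1.
  rewrite -(mulmxA U) mulmx_block.
  by rewrite !mulmx1 !mulmx0 !addr0 !add0r.
by rewrite /geninv AP mpinv_unitary // mpinv_block.
Qed.
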